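(* Let $n,k\ge1$ and let $\mathbb{S}\subset\mathbb{L}=\mathbb{Z}^n$ be a sublattice of full rank $n$. Let $F$ be either $\mathbb{C}$ or an algebraically closed field of characteristic $p>0$ with $p$ relatively prime to the index $[\mathbb{Z}^n:\mathbb{S}]$. Let $A=F[\sigma_1,\sigma_1^{-1},\ldots,\sigma_n,\sigma_n^{-1}]$ and let $P$ be an $A$-submodule of $A^k$. Then the system $\ker_{\mathcal{F}_{\mathbb{L}}}(P)$ on $\mathbb{L}$ is the extension of a system on the sublattice $\mathbb{S}$ if and only if $P$ is $\mathrm{Aut}_{A_S}(A)$-invariant, i.e. $g(P)=P$ for every $g\in\mathrm{Aut}_{A_S}(A)$.
   Context: For $x\in\mathbb{Z}^n$ write $\sigma^x=\sigma_1^{x_1}\cdots\sigma_n^{x_n}\in A$. $\mathcal{F}_{\mathbb{L}}$ is the set of all functions $\mathbb{Z}^n\to F$, an $A$-module via $(\sigma^y f)(x)=f(x+y)$. For an $A$-submodule $P\subset A^k$, $\ker_{\mathcal{F}_{\mathbb{L}}}(P)=\{(f_1,\ldots,f_k)\in\mathcal{F}_{\mathbb{L}}^k : \sum_j p_jf_j=0 \text{ for all } (p_1,\ldots,p_k)\in P\}$. A sublattice is a subgroup of $\mathbb{Z}^n$. $A_S\subset A$ is the $F$-subalgebra spanned by the monomials $\sigma^x$, $x\in\mathbb{S}$; $\mathcal{F}_{\mathbb{S}}$ is the $A_S$-module of all functions $\mathbb{S}\to F$, with action $(\sigma^y f)(x)=f(x+y)$ for $x,y\in\mathbb{S}$. A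 system on $\mathbb{S}$ is a set of the form $\ker_{\mathcal{F}_{\mathbb{S}}}(Q)=\{(f_1,\ldots,f_k)\in\mathcal{F}_{\mathbb{S}}^k : \sum_j q_jf_j=0 \text{ for all } (q_1,\ldots,q_k)\in Q\}$ for an $A_S$-submodule $Q\subset A_S^k$; its extension to $\mathbb{L}$ is the system $\ker_{\mathcal{F}_{\mathbb{L}}}(Q^e)$, where $Q^e$ is the $A$-submodule of $A^k$ generated by $Q$. $\mathrm{Aut}_{A_S}(A)$ is the group of $F$-algebra automorphisms of $A$ that fix every element of $A_S$; it acts on $A^k$ coordinatewise, $g(a_1,\ldots,a_k)=(g(a_1),\ldots,g(a_k))$. *)

(* Defs.v *)
From HB Require Import structures.
From mathcomp Require Import all_boot all_order all_algebra finmap.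
From mathcomp Require Import boolp classical_sets functions cardinality fsbigop reals.
From mathcomp Require Import complex monalg.

Set Implicit Arguments.
Unset Strict Implicit.
Unset Printing Implicit Defensive.

Import GRing.Theory.
Local Open Scope classical_set_scope.
Local Open Scope ring_scope.

(* The library makes [{malg F[K]}] a ring only for a monoid [K] without
   nontrivial units, which excludes Z^n: the additive and linear structures
   below are the library's, the convolution product is added here. *)
Definition laurent (F : fieldType) (n : nat) : Type := {malg F['rV[int]_n]}.

HB.instance Definition _ (F : fieldType) n :=
  GRing.Lmodule.copy (laurent F n) {malg F['rV[int]_n]}.

Definition sigma (F : fieldType) n (x : 'rV[int]_n) : laurent F n := << x >>.

Section LaurentRing.
Variables (F : fieldType) (n : nat).
Local Notation A := (laurent F n).
Local Notation L := 'rV[int]_n.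
Implicit Types (a b c : A) (x y : L).

Definition laurent_mul a b : A :=
  \sum_(x <- msupp a) \sum_(y <- msupp b) << a@_x * b@_y *g x + y >>.

Lemma laurent_mulw (d e : {fset L}) a b :
  (msupp a `<=` d)%fset -> (msupp b `<=` e)%fset ->
  laurent_mul a b =
    \sum_(x <- d) \sum_(y <- e) (<< a@_x * b@_y *g x + y >> : A).
Proof.
move=> ad be; rewrite /laurent_mul (big_fset_incl _ ad) /=.
  apply/eq_bigr=> x _; apply/big_fset_incl => // y _ /mcoeff_outdom ->.
  by rewrite mulr0 monalgU0.
move=> x _ /mcoeff_outdom ax.
by rewrite big1 => // y _; rewrite ax mul0r monalgU0.
Qed.

Lemma laurent_mulC : commutative laurent_mul.
Proof.
move=> a b; rewrite /laurent_mul exchange_big /=.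
by apply: eq_bigr => x _; apply: eq_bigr => y _; rewrite mulrC addrC.
Qed.

Lemma laurent_mulDl : left_distributive laurent_mul +%R.
Proof.
move=> a b c.
have le_ab : (msupp (a + b : A) `<=` msupp a `|` msupp b)%fset.
  exact: msuppD_le.
rewrite [in RHS](laurent_mulw (fsubsetUl _ (msupp b)) (fsubset_refl _)).
rewrite [in RHS](laurent_mulw (fsubsetUr (msupp a) _) (fsubset_refl _)).
rewrite (laurent_mulw le_ab (fsubset_refl _)).
rewrite -big_split /=; apply/eq_bigr=> x _.
rewrite -big_split /=; apply/eq_bigr=> y _.
by rewrite mcoeffD mulrDl monalgUD.
Qed.

Lemma laurent_mulDr : right_distributive laurent_mul +%R.
Proof. by move=> a b c; rewrite ![laurent_mul a _]laurent_mulC laurent_mulDl. Qed.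

Lemma laurent_mul0l : left_zero 0 laurent_mul.
Proof. by move=> a; rewrite /laurent_mul msupp0 big_seq_fset0. Qed.

Lemma laurent_mul0r : right_zero 0 laurent_mul.
Proof. by move=> a; rewrite laurent_mulC laurent_mul0l. Qed.

Lemma laurent_mulUU (u v : F) x y :
  laurent_mul << u *g x >> << v *g y >> = << u * v *g x + y >>.
Proof.
by rewrite (laurent_mulw msuppU_le msuppU_le) !big_seq_fset1 !mcoeffUU.
Qed.

Lemma laurent_mul_suml (I : Type) (r : seq I) (f : I -> A) b :
  laurent_mul (\sum_(i <- r) f i) b = \sum_(i <- r) laurent_mul (f i) b.
Proof.
exact: (big_morph (laurent_mul^~ b) (fun _ _ => laurent_mulDl _ _ _)
  (laurent_mul0l _)).
Qed.

Lemma laurent_mul_sumr (I : Type) (r : seq I) (f : I -> A) b :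
  laurent_mul b (\sum_(i <- r) f i) = \sum_(i <- r) laurent_mul b (f i).
Proof.
exact: (big_morph (laurent_mul b) (fun _ _ => laurent_mulDr _ _ _)
  (laurent_mul0r _)).
Qed.

Lemma laurent_mulA : associative laurent_mul.
Proof.
move=> a b c.
have EA (d : A) : d = \sum_(x <- msupp d) (<< d@_x *g x >> : A).
  exact: monalgE.
rewrite {1}(EA a) [in RHS](EA a) !laurent_mul_suml; apply: eq_bigr => x _.
rewrite [in LHS](EA b) [in RHS](EA b).
rewrite laurent_mul_sumr !laurent_mul_suml laurent_mul_sumr.
apply: eq_bigr => y _.
rewrite [in LHS](EA c) [in RHS](EA c) !laurent_mul_sumr.
by apply: eq_bigr => z _; rewrite !laurent_mulUU mulrA addrA.
Qed.

Lemma laurent_mul1l : left_id (sigma F 0) laurent_mul.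
Proof.
move=> a; rewrite {1}(monalgE a) laurent_mul_sumr [RHS]monalgE.
by apply: eq_bigr => x _; rewrite laurent_mulUU mul1r add0r.
Qed.

Lemma laurent_1neq0 : sigma F (0 : L) != 0.
Proof. by rewrite monalgU_eq0 oner_neq0. Qed.

HB.instance Definition _ := GRing.Zmodule_isComNzRing.Build (laurent F n)
  laurent_mulA laurent_mulC laurent_mul1l laurent_mulDl laurent_1neq0.

Lemma laurent_scaleAl (u : F) a b : u *: (a * b) = (u *: a) * b.
Proof.
have scaleE (d : A) : u *: d = laurent_mul << u *g 0 >> d.
  have ED : d = \sum_(x <- msupp d) (<< d@_x *g x >> : A) by exact: monalgE.
  rewrite [in RHS]ED laurent_mul_sumr [LHS]malgZ_def.
  by apply: eq_bigr => x _; rewrite laurent_mulUU add0r.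
by rewrite !scaleE [LHS]laurent_mulA.
Qed.

HB.instance Definition _ :=
  GRing.Lmodule_isLalgebra.Build F (laurent F n) laurent_scaleAl.
HB.instance Definition _ := GRing.Lalgebra_isComAlgebra.Build F (laurent F n).

Lemma sigmaD x y : sigma F (x + y) = sigma F x * sigma F y.
Proof. by rewrite [RHS]laurent_mulUU mulr1. Qed.

End LaurentRing.

Section Sublattice.
Variables (n : nat) (S : zmodClosed 'rV[int]_n).

Definition lattice : Type := {x : 'rV[int]_n | x \in S}.

HB.instance Definition _ := SubChoice.on lattice.
HB.instance Definition _ := [SubChoice_isSubZmodule of lattice by <:].

Definition full_rank : Prop :=
  exists M : 'M[int]_n,
    (forall i, row i M \in S) /\ \rank (map_mx intr M : 'M[rat]_n) = n.

Definition cosets : set (set 'rV[int]_n) :=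
  [set [set x + s | s in [set` S]] | x in [set: 'rV[int]_n]].

(* [fset_set] maps an infinite set to the empty one; a sublattice of full rank
   has finitely many cosets. *)
Definition lattice_index : nat := #|` fset_set cosets|%fset.

End Sublattice.

Section SubAlgebra.
Variables (F : fieldType) (n : nat) (S : zmodClosed 'rV[int]_n).
Local Notation A := (laurent F n).

Definition monomial_span : {pred A} := fun a =>
  `[< exists s : seq (F * lattice S),
        a = \sum_(t <- s) t.1 *: sigma F (val t.2) >].

Lemma monomial_span_subring : subring_closed monomial_span.
Proof.
split=> [|a b /asboolP[s ->] /asboolP[t ->]|a b /asboolP[s ->] /asboolP[t ->]].
- apply/asboolP; exists [:: (1, 0)].
  by rewrite big_seq1 scale1r raddf0.
- apply/asboolP; exists (s ++ [seq (- u.1, u.2) | u <- t]).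
  rewrite big_cat big_map /= -sumrN; congr (_ + _).
  by apply: eq_bigr => u _; rewrite scaleNr.
- apply/asboolP; exists [seq (u.1 * v.1, u.2 + v.2) | u <- s, v <- t].
  rewrite big_allpairs_dep mulr_suml; apply: eq_bigr => u _.
  rewrite mulr_sumr; apply: eq_bigr => v _ /=.
  by rewrite -scalerAl -scalerAr scalerA -sigmaD.
Qed.

HB.instance Definition _ :=
  GRing.isSubringClosed.Build A monomial_span monomial_span_subring.

Definition sublaurent : Type := {a : A | a \in monomial_span}.

HB.instance Definition _ := SubChoice.on sublaurent.
HB.instance Definition _ := [SubChoice_isSubComNzRing of sublaurent by <:].

End SubAlgebra.

(* The sum has finite support when [c] is the coefficient function of a Laurent
   polynomial, the only case used. *)
Definition shift_act (F : fieldType) (G : zmodType) (c f : G -> F) : G -> F :=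
  fun x => \sum_(y \in [set: G]) c y * f (x + y).

Section Systems.
Variables (F : fieldType) (n k : nat) (S : zmodClosed 'rV[int]_n).
Local Notation A := (laurent F n).
Local Notation AS := (sublaurent F S).

Definition act_L (a : A) (f : 'rV[int]_n -> F) : 'rV[int]_n -> F :=
  shift_act (fun y => a@_y) f.

Definition act_S (q : AS) (f : lattice S -> F) : lattice S -> F :=
  shift_act (fun y => (val q)@_(val y)) f.

Definition ker_L (P : set 'rV[A]_k) : set ('I_k -> 'rV[int]_n -> F) :=
  [set f | forall p, P p -> forall x, \sum_(j < k) act_L (p ord0 j) (f j) x = 0].

Definition ker_S (Q : set 'rV[AS]_k) : set ('I_k -> lattice S -> F) :=
  [set f | forall q, Q q -> forall x, \sum_(j < k) act_S (q ord0 j) (f j) x = 0].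

Definition is_submodule (R : comNzRingType) (M : set 'rV[R]_k) : Prop :=
  submod_closed [in M].

Definition extended_module (Q : set 'rV[AS]_k) : set 'rV[A]_k :=
  smallest (@is_submodule A) [set map_mx val q | q in Q].

Definition is_system_S (B : set ('I_k -> lattice S -> F)) : Prop :=
  exists2 Q : set 'rV[AS]_k, is_submodule Q & B = ker_S Q.

Definition is_extension (C : set ('I_k -> 'rV[int]_n -> F))
    (B : set ('I_k -> lattice S -> F)) : Prop :=
  exists Q : set 'rV[AS]_k,
    [/\ is_submodule Q, B = ker_S Q & C = ker_L (extended_module Q)].

Definition is_aut_over (g : {lrmorphism A -> A}) : Prop :=
  bijective g /\ forall a : AS, g (val a) = val a.

Definition aut_invariant (P : set 'rV[A]_k) : Prop :=
  forall g : {lrmorphism A -> A}, is_aut_over g -> [set map_mx g p | p in P] = P.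

End Systems.

Definition is_complex_field (F : fieldType) : Prop :=
  exists (R : realType) (phi : {rmorphism F -> R[i]}), bijective phi.

(* Main.v *)
Require Import Defs.
From HB Require Import structures.
From mathcomp Require Import all_boot all_order all_algebra all_field finmap.
From mathcomp Require Import boolp classical_sets functions cardinality fsbigop reals.
From mathcomp Require Import complex monalg.

(* The system [ker_L P] determines [P]: a Laurent vector [p] outside [P] is
   separated from [P] by an F-linear functional [phi], and the functions
   x |-> phi (sigma^x e_j) lie in [ker_L P] but not in [ker_L {p}]. So the
   statement is about modules: [P] is generated by vectors over A_S iff it is
   invariant. A generated module is clearly invariant. Conversely, fix [m]
   invertible in F with m Z^n inside S and a primitive [m]-th root of unity. A
   character of Z^n that is trivial on S and has values in the [m]-th roots of
   unity gives an automorphism sigma^x |-> chi(x) sigma^x over A_S. By Fourier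
   inversion on (Z/m)^n, the sum [pi] of all of them projects A onto A_S up to
   a nonzero scalar, and preserves [P]; then [p] is recovered, up to the scalar
   m^n, as the sum of sigma^b pi(sigma^-b p) over the residues [b] modulo m. *)

Set Implicit Arguments.
Unset Strict Implicit.
Unset Printing Implicit Defensive.
Import GRing.Theory.
Local Open Scope ring_scope.

(** * Monomial expansions and automorphisms given by characters of Z^n *)

Section LaurentExpansion.
Variables (F : fieldType) (n : nat).
Local Notation A := (laurent F n).
Implicit Types (a b : A) (x y : 'rV[int]_n).

Lemma laurentU (c : F) x : (<< c *g x >> : A) = c *: sigma F x.
Proof. by apply/malgP => y; rewrite [LHS]mcoeffU [RHS]mcoeffZ mcoeffU mulrnAr mulr1. Qed.

Lemma laurentE a : a = \sum_(x <- msupp a) a@_x *: sigma F x.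
Proof.
by rewrite {1}[a]monalgE; apply: eq_bigr => x _; rewrite laurentU.
Qed.

End LaurentExpansion.
Section Twist.
Variables (F : fieldType) (n : nat) (chi : 'rV[int]_n -> F).
Hypotheses (chi0 : chi 0 = 1) (chiD : {morph chi : x y / x + y >-> x * y}).
Local Notation A := (laurent F n).
Implicit Types (a b : A) (x y : 'rV[int]_n).

Definition twist a : A := [malg x in msupp a => chi x * a@_x].

Lemma mcoeff_twist a x : (twist a)@_x = chi x * a@_x.
Proof.
by rewrite mcoeffE; case: ifPn => // /mcoeff_outdom ->; rewrite mulr0.
Qed.

Lemma twist_linear : linear twist.
Proof.
move=> c a b; apply/malgP => x; rewrite [LHS]mcoeff_twist mcoeffD mcoeffZ.
by rewrite [RHS]mcoeffD mcoeffZ !mcoeff_twist mulrDr mulrCA.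
Qed.

HB.instance Definition _ := GRing.isLinear.Build F A A _ twist twist_linear.

Lemma twist_sigma x : twist (sigma F x) = chi x *: sigma F x.
Proof.
apply/malgP => y; rewrite mcoeff_twist mcoeffZ mcoeffU.
by case: eqP => [->|_]; rewrite // mulr0n !mulr0.
Qed.

Lemma twist_sum (I : Type) (r : seq I) (f : I -> A) :
  twist (\sum_(i <- r) f i) = \sum_(i <- r) twist (f i).
Proof. exact: raddf_sum. Qed.

Lemma twistZ (c : F) a : twist (c *: a) = c *: twist a.
Proof. exact: linearZ. Qed.

Lemma twistE a : twist a = \sum_(x <- msupp a) (a@_x * chi x) *: sigma F x.
Proof.
rewrite {1}(laurentE a) [LHS]twist_sum; apply: eq_bigr => x _.
by rewrite [LHS]twistZ twist_sigma scalerA.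
Qed.

Lemma twist_monoid_morphism : monoid_morphism twist.
Proof.
split=> [|a b]; first by rewrite -[1]/(sigma F 0) twist_sigma chi0 scale1r.
rewrite (twistE a) (twistE b) [in LHS](laurentE a) [in LHS](laurentE b).
rewrite [in LHS]mulr_suml [LHS]twist_sum [RHS]mulr_suml; apply: eq_bigr => x _.
rewrite [in LHS]mulr_sumr [LHS]twist_sum [RHS]mulr_sumr; apply: eq_bigr => y _.
rewrite -[in LHS]scalerAl -[in LHS]scalerAr -sigmaD.
rewrite [LHS]twistZ [in LHS]twistZ twist_sigma chiD sigmaD.
rewrite -[RHS]scalerAl -[in RHS]scalerAr ![in LHS]scalerA [RHS]scalerA.
by rewrite [X in X *: _ = _]mulrACA.
Qed.

HB.instance Definition _ :=
  GRing.isMonoidMorphism.Build A A twist twist_monoid_morphism.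

Definition twist_lrmorphism : {lrmorphism A -> A} := twist.

End Twist.

Lemma twistK (F : fieldType) n (chi psi : 'rV[int]_n -> F) :
  (forall x, chi x * psi x = 1) -> cancel (twist chi) (twist psi).
Proof.
move=> chiK a; apply/malgP => x.
by rewrite !mcoeff_twist mulrA [psi x * _]mulrC chiK mul1r.
Qed.

Section TwistAut.
Variables (F : fieldType) (n : nat) (S : zmodClosed 'rV[int]_n).
Variables (chi : 'rV[int]_n -> F).
Hypotheses (chi0 : chi 0 = 1) (chiD : {morph chi : x y / x + y >-> x * y}).
Hypothesis chiS : forall x, x \in S -> chi x = 1.
Local Notation A := (laurent F n).

Lemma twist_is_aut_over : is_aut_over S (twist_lrmorphism chi0 chiD).
Proof.
split.
  have chiNK x : chi x * chi (- x) = 1 by rewrite -chiD subrr chi0.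
  exists (twist (chi \o -%R)); apply: twistK => x //=.
  by rewrite mulrC.
case=> a /= /asboolP[s ->]; rewrite [LHS]twist_sum; apply: eq_bigr => t _.
by rewrite [LHS]twistZ twist_sigma chiS ?scale1r //; exact: valP.
Qed.

End TwistAut.

Lemma supp_monomial_span (F : fieldType) n (S : zmodClosed 'rV[int]_n)
    (a : laurent F n) :
  (forall x, a@_x != 0 -> x \in S) -> a \in @monomial_span F n S.
Proof.
move=> aS; apply/asboolP.
(* The default 0 is never taken: every exponent in the support lies in [S]. *)
exists [seq (a@_x, insubd (0 : lattice S) x) | x <- msupp a].
apply: (etrans (laurentE a)); apply: esym; apply: (etrans (big_map _ _ _)).
apply: eq_big_seq => x xa; rewrite /= insubdK //.
by apply: aS; rewrite mcoeff_neq0.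
Qed.

(** * Submodules and separating functionals *)

Section SubmoduleClosure.
Variables (R : comNzRingType) (k : nat) (M : set 'rV[R]_k).
Hypothesis hM : is_submodule M.

Lemma submodule0 : M 0.
Proof. by have [/set_mem] := hM. Qed.

Lemma submoduleZD a u v : M u -> M v -> M (a *: u + v).
Proof.
by move=> Mu Mv; have [_ hZ] := hM; apply/set_mem/hZ; rewrite inE.
Qed.

Lemma submoduleZ a u : M u -> M (a *: u).
Proof. by move=> Mu; rewrite -[_ *: _]addr0; exact: submoduleZD submodule0. Qed.

Lemma submoduleD u v : M u -> M v -> M (u + v).
Proof. by move=> Mu; rewrite -[u]scale1r; exact: submoduleZD. Qed.

Lemma submodule_sum (I : Type) (r : seq I) (P : pred I) (u : I -> 'rV[R]_k) :
  (forall i, P i -> M (u i)) -> M (\sum_(i <- r | P i) u i).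
Proof.
by move=> Mu; elim/big_rec: _ => [|i v Pi Mv];
  [exact: submodule0 | exact: submoduleD (Mu i Pi) Mv].
Qed.

End SubmoduleClosure.

Lemma is_submoduleP (R : comNzRingType) (k : nat) (M : set 'rV[R]_k) :
  M 0 -> (forall a u v, M u -> M v -> M (a *: u + v)) -> is_submodule M.
Proof.
by move=> M0 MZD; split=> [|a u v]; rewrite !inE => //; exact: MZD.
Qed.

(* A subspace maximal among those containing [M] and avoiding [p] has
   codimension 1. *)
Lemma separating_functional (F : fieldType) (A : algType F) (V : lmodType A)
    (M : set V) (p : V) :
  M 0 -> (forall (c : F) u v, M u -> M v -> M (c%:A *: u + v)) -> ~ M p ->
  exists phi : V -> F,
    [/\ forall (c : F) u v, phi (c%:A *: u + v) = c * phi u + phi v,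
        forall v, M v -> phi v = 0 & phi p = 1].
Proof.
move=> M0 MZD Mp.
pose sub (N : set V) := forall (c : F) u v, N u -> N v -> N (c%:A *: u + v).
(* The conditions are put on the union with [M], so that they also hold for the empty set, which is
   the union of the empty chain in Zorn's lemma. *)
pose P (N : set V) := sub (M `|` N)%classic /\ ~ (M `|` N)%classic p.
have scD (c d : F) : (c + d)%:A = c%:A + d%:A :> A by rewrite scalerDl.
have scM (c d : F) (v : V) : (c * d)%:A *: v = c%:A *: (d%:A *: v).
  by rewrite scalerA -scalerAl mul1r scalerA.
have sc1 (v : V) : (1 : F)%:A *: v = v by rewrite !scale1r.
have sc0 (v : V) : (0 : F)%:A *: v = 0 by rewrite !scale0r.
have scN (c : F) (v : V) : (- c)%:A *: v = - (c%:A *: v) by rewrite !scaleNr.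
have [|N [[Nsub Np] Nmax]] := @Zorn_bigcup V P.
  move=> C CP Ctot; split; last first.
    by case=> // -[X CX Xp]; case: (CP _ CX) => _; apply; right.
  have sup u v : (M `|` \bigcup_(X in C) X)%classic u ->
      (M `|` \bigcup_(X in C) X)%classic v ->
      (M u /\ M v) \/
      exists2 X, C X & (M `|` X)%classic u /\ (M `|` X)%classic v.
    case=> [Mu|[X CX Xu]] [Mv|[Y CY Yv]]; first by left.
    - by right; exists Y => //; split; [left|right].
    - by right; exists X => //; split; [right|left].
    - have [XY|YX] := Ctot _ _ CX CY; right.
        by exists Y => //; split; right => //; apply: XY.
      by exists X => //; split; right => //; apply: YX.
  move=> c u v Mu Mv; have [[Mu' Mv']|[X CX [Xu Xv]]] := sup _ _ Mu Mv.
    by left; exact: MZD.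
  have [Xsub _] := CP _ CX; have [MX|XX] := Xsub c _ _ Xu Xv; first by left.
  by right; exists X.
set B := (M `|` N)%classic in Nsub Np.
have B0 : B 0 by left.
have BZ (c : F) u : B u -> B (c%:A *: u).
  by move=> Bu; rewrite -[_ *: _]addr0; exact: Nsub.
have codim1 v : exists c : F, B (v - c%:A *: p).
  have [Bv|Bv] := pselect (B v); first by exists 0; rewrite sc0 subr0.
  (* The span of [v] and [B] strictly contains [N], so by maximality it contains [p]. Solving p = c
     v + b for [v] yields the scalar c^-1. *)
  pose N' : set V := [set w | exists (c : F) b, B b /\ w = c%:A *: v + b]%classic.
  have MN' : (M `|` N')%classic = N'.
    apply/seteqP; split=> [w [Mw|//]|w]; last by right.
    by exists 0, w; split; [left|rewrite sc0 add0r].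
  have N'sub : sub N'.
    move=> c _ _ [d [b [Bb ->]]] [e [b' [Bb' ->]]].
    exists (c * d + e), (c%:A *: b + b'); split; first exact: Nsub.
    by rewrite scalerDr scD scalerDl scM addrACA.
  have [/= [c [b [Bb pE]]]|N'p] := pselect (N' p); last first.
    case: (Nmax N'); last by split; rewrite MN'.
    split=> [w Nw|NN']; first by exists 0, w; split; [right|rewrite sc0 add0r].
    by apply: Bv; right; apply: NN'; exists 1, 0; rewrite sc1 addr0.
  have c0 : c != 0.
    by apply: contra_notN Np => /eqP c0; rewrite pE c0 sc0 add0r.
  exists c^-1; rewrite pE scalerDr -scM mulVf // sc1 opprD addNKr -scN.
  exact: BZ.
have [phi phiE] := choice codim1.
(* Since [p] is outside [B], the scalar attached to [v] is unique; hence the function obtained by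
   choice is linear. *)
have phiU c v : B (v - c%:A *: p) -> phi v = c.
  move=> Bc; apply/eqP; rewrite -subr_eq0; apply: contra_notT Np => d0.
  have {}Bc : B ((phi v - c)%:A *: p).
    have -> : (phi v - c)%:A *: p =
        (-1 : F)%:A *: (v - (phi v)%:A *: p) + (v - c%:A *: p).
      by rewrite scN sc1 opprB addrA subrK scD scalerDl scN.
    exact: Nsub.
  by rewrite -[p]sc1 -(mulVf d0) scM; exact: BZ.
exists phi; split=> [c u v|v Mv|].
- apply: phiU; have := Nsub c _ _ (phiE u) (phiE v).
  by rewrite scalerBr -scM scD scalerDl opprD addrACA.
- by apply: phiU; rewrite sc0 subr0; left.
- by apply: phiU; rewrite sc1 subrr.
Qed.

(** * Recovering a module from its kernel *)

Section KernelDuality.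
Variables (F : fieldType) (n k : nat).
Local Notation A := (laurent F n).

Lemma act_LE (a : A) f x : act_L a f x = \sum_(y <- msupp a) a@_y * f (x + y).
Proof.
by apply: fsbigTE => y /mcoeff_outdom ->; rewrite mul0r.
Qed.

(** The vector [p] is the F-combination of the vectors sigma^y e_j with the coefficients of its
    entries, and shifting the argument by [x] multiplies each of them by sigma^x. *)
Lemma act_functional (phi : 'rV[A]_k -> F) (p : 'rV[A]_k) x :
  (forall (c : F) u v, phi (c%:A *: u + v) = c * phi u + phi v) ->
  \sum_(j < k) act_L (p ord0 j) (fun y => phi (sigma F y *: delta_mx 0 j)) x =
  phi (sigma F x *: p).
Proof.
move=> phiL.
have phiD u v : phi (u + v) = phi u + phi v.
  by have := phiL 1 u v; rewrite scale1r scale1r mul1r.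
have phi0 : phi 0 = 0.
  by apply: (addrI (phi 0)); rewrite -phiD !addr0.
have phiZ c u : phi (c%:A *: u) = c * phi u.
  by rewrite -[_ *: u]addr0 phiL phi0 addr0.
have phi_sum (I : Type) (r : seq I) (f : I -> 'rV[A]_k) :
    phi (\sum_(i <- r) f i) = \sum_(i <- r) phi (f i).
  exact: (big_morph phi phiD phi0).
rewrite [in RHS](row_sum_delta p) scaler_sumr phi_sum.
apply: eq_bigr => j _; rewrite act_LE.
rewrite [in RHS](laurentE (p ord0 j)) scaler_suml scaler_sumr phi_sum.
apply: eq_bigr => y _; rewrite -phiZ; apply: (congr1 phi).
rewrite [LHS]scalerA [RHS]scalerA; apply: (congr1 (fun a : A => a *: _)).
by rewrite sigmaD -[LHS]scalerAl [X in _ *: X]mul1r -[RHS]scalerAr.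
Qed.

(** If [p] in [P'] were outside [P], a functional killing [P] with value 1 at [p] would define a
    solution of [P]; the equation [p] at the point 0 would then read 1 = 0. *)
Lemma ker_L_subset (P P' : set 'rV[A]_k) :
  is_submodule P -> (ker_L P `<=` ker_L P')%classic -> (P' `<=` P)%classic.
Proof.
move=> hP kerPP' p P'p; apply: contrapT => Pp.
have [||//|phi [phiL phiP phip]] := @separating_functional F A _ P p.
- exact: submodule0 hP.
- by move=> c u v; exact: submoduleZD.
have /kerPP' /(_ p P'p 0) : ker_L P (fun j y => phi (sigma F y *: delta_mx 0 j)).
  move=> q Pq x; rewrite act_functional //; apply: phiP.
  exact: submoduleZ.
rewrite act_functional // -[sigma F 0]/(1 : A) scale1r phip => /eqP.
by rewrite oner_eq0.
Qed.

End KernelDuality.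

(** * Invariance of modules generated over A_S *)

Section ExtendedModule.
Variables (F : fieldType) (n k : nat) (S : zmodClosed 'rV[int]_n).
Local Notation A := (laurent F n).
Local Notation AS := (sublaurent F S).
Variable Q : set 'rV[AS]_k.

Lemma extended_module_submodule : is_submodule (extended_module Q).
Proof.
apply: is_submoduleP => [|a u v Qu Qv] M [hM QM]; first exact: submodule0 hM.
by apply: submoduleZD => //; [exact: Qu|exact: Qv].
Qed.

(** The generators are fixed by [g], so the preimage and the image of the extended module under [g]
    are submodules containing them. Minimality gives one inclusion from each; for the image, a
    scalar [a] is pulled back through the inverse [h]. *)
Lemma extended_module_aut_invariant : aut_invariant S (extended_module Q).
Proof.
move=> g [[h gK hK] gS]; have hQ := extended_module_submodule.
apply/seteqP; split.
  suff sub : (extended_module Q `<=`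
      [set v | extended_module Q (map_mx g v)])%classic.
    by move=> _ [v Qv <-]; exact: sub.
  apply: smallest_sub => [|_ [q Qq <-]].
    apply: is_submoduleP => [|a u v] /=.
      by rewrite map_mx0; exact: submodule0 hQ.
    by move=> Qu Qv; rewrite map_mxD map_mxZ; apply: (submoduleZD hQ).
  rewrite /= (_ : map_mx g _ = map_mx val q); last first.
    by apply/matrixP => i j; rewrite !mxE gS.
  by apply: sub_gen_smallest; exists q.
apply: smallest_sub => [|_ [q Qq <-]].
  apply: is_submoduleP => [|a _ _ [u Qu <-] [v Qv <-]] /=.
    by exists 0; [exact: submodule0 hQ|rewrite map_mx0].
  exists (h a *: u + v); first exact: (submoduleZD hQ).
  by rewrite map_mxD map_mxZ /= hK.
exists (map_mx val q); first by apply: sub_gen_smallest; exists q.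
by apply/matrixP => i j; rewrite !mxE gS.
Qed.

End ExtendedModule.

(** * Multiples of Z^n inside the sublattice, and roots of unity *)

Section Exponent.
Variables (n : nat) (S : zmodClosed 'rV[int]_n).
Implicit Types x y : 'rV[int]_n.

(** By the adjugate identity, x det(M) = (x adj(M)) M is an integer combination of the rows of [M],
    which lie in [S]. *)
Lemma full_rank_exponent :
  full_rank S -> exists2 m : nat, (0 < m)%N & forall x, x *+ m \in S.
Proof.
case=> M [MS rkM]; exists `|\det M|%N => [|x].
  have : (map_mx intr M : 'M[rat]_n) \in unitmx.
    by rewrite -row_free_unit /row_free rkM.
  by rewrite unitmxE det_map_mx unitfE intr_eq0 absz_gt0.
have : x *~ \det M \in S.
  rewrite -scaler_int intz -mul_mx_scalar -(mul_adj_mx M) mulmxA mulmx_sum_row.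
  by apply: rpred_sum => i _; rewrite -[_ 0 i]intz scaler_int rpredMz.
by case: (\det M) => d //=; rewrite NegzE mulrNz rpredN.
Qed.

(* Translation by [x] permutes the cosets; comparing the sum of coset
   representatives with its translate yields [x *+ #|L : S| \in S]. *)
Lemma lattice_index_exponent x :
  finite_set (cosets S) -> x *+ lattice_index S \in S.
Proof.
move=> Cfin.
have cosetE y z : [set y + s | s in [set` S]]%classic z <-> z - y \in S.
  split=> [[s Ss <-]|Szy]; first by rewrite addrC addKr.
  by exists (z - y) => //; rewrite addrC subrK.
have coset_shift y z : [set z + w | w in [set y + s | s in [set` S]]]%classic =
    [set (z + y) + s | s in [set` S]]%classic.
  rewrite image_comp; apply/seteqP; split=> _ [s Ss <-]; exists s => //=;
    by rewrite addrA.
(* Cosets are nonempty, so on them the default 0 is not what makes [rep] a choice of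
   representative. *)
pose rep (X : set 'rV[int]_n) := xget 0 X.
have repP X : cosets S X -> X (rep X).
  case=> y _ <-; apply: (xgetPex 0); exists y.
  by apply/cosetE; rewrite subrr rpred0.
pose T (X : set 'rV[int]_n) := [set x + w | w in X]%classic.
have Tbij : set_bij (cosets S) (cosets S) T.
  split.
  - by move=> _ [y _ <-]; rewrite /T coset_shift; exists (x + y).
  - have TK : cancel T (fun X : set _ => [set - x + w | w in X]%classic).
      move=> X; rewrite /T image_comp -[RHS]image_id.
      by apply: eq_imagel => w _ /=; rewrite addKr.
    by move=> X Y _ _; exact: (can_inj TK).
  - move=> _ [y _ <-]; exists [set (y - x) + s | s in [set` S]]%classic.
      by exists (y - x).
    by rewrite /T coset_shift addrC subrK.
have step X : cosets S X -> rep (T X) - rep X - x \in S.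
  move=> CX; have := repP _ CX; have := repP _ (set_bij_homo Tbij CX).
  move: (rep (T X)) (rep X) => u v; case: CX => y _ <-.
  rewrite /T coset_shift => /cosetE uS /cosetE vS.
  have := rpredB uS vS.
  by rewrite !opprD opprK addrA [X in X + _]addrAC addrA addrNK.
have : \sum_(X <- fset_set (cosets S)) (rep (T X) - rep X - x) \in S.
  rewrite big_seq rpred_sum // => X; rewrite in_fset_set // inE; exact: step.
rewrite 2!sumrB -(fsbig_finite _ (fun X => rep (T X)) Cfin).
rewrite -(fsbig_finite _ rep Cfin) -(reindex_fsbig _ _ _ _ Tbij) subrr sub0r.
by rewrite rpredN big_const_seq count_predT iter_addr_0.
Qed.

End Exponent.

(** In characteristic 0 any positive multiple is invertible, so a determinant serves. In
    characteristic p a determinant might be divisible by p, and the index takes its place. *)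
Lemma invertible_exponent n (S : zmodClosed 'rV[int]_n) (F : fieldType) :
  full_rank S ->
  (is_complex_field F \/
   exists2 p : nat, p \in [pchar F] & coprime p (lattice_index S)) ->
  exists2 m : nat, m%:R != 0 :> F & forall x, x *+ m \in S.
Proof.
move=> hS [[R [phi phibij]]|[p pF pS]].
  have [m m0 mS] := full_rank_exponent hS; exists m => //.
  apply: contraTneq m0 => /(congr1 phi) /eqP.
  by rewrite rmorph_nat rmorph0 Num.Theory.pnatr_eq0 => /eqP ->.
exists (lattice_index S).
  rewrite -(dvdn_pcharf pF) -prime_coprime //; exact: pcharf_prime pF.
(* With infinitely many cosets [lattice_index] would be 0 by the convention of [fset_set], and
   coprimality to 0 would force p = 1. *)
move=> x; apply: lattice_index_exponent; apply: contrapT => Cinf.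
have := pS; rewrite /lattice_index.
have -> : fset_set (cosets S) = fset0 by rewrite /fset_set; case: pselect.
rewrite cardfs0 /coprime gcdn0 => /eqP p1.
by have := pcharf_prime pF; rewrite p1.
Qed.

(** As [m] is invertible, X^m - 1 is separable. It splits into [m] distinct linear factors, and
    among [m] distinct [m]-th roots of unity one is primitive. *)
Lemma closed_field_prim_root (F : closedFieldType) (m : nat) :
  m%:R != 0 :> F -> exists z : F, m.-primitive_root z.
Proof.
move=> m0; have m_gt0 : (0 < m)%N by case: m m0 => //; rewrite eqxx.
have [rs rsE] := closed_field_poly_normal ('X^m - 1 : {poly F}).
rewrite lead_coefXnsubC // scale1r in rsE.
have : has m.-primitive_root rs.
  apply: cyclic.has_prim_root => //.
  - apply/allP => z zrs; rewrite unity_rootE -subr_eq0.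
    have : root ('X^m - 1) z by rewrite rsE root_prod_XsubC.
    by rewrite rootE !hornerE.
  - by rewrite -separable_prod_XsubC -rsE separable_Xn_sub_1.
  - by have := size_prod_XsubC rs id; rewrite -rsE size_XnsubC // => -[<-].
by case/hasP => z _; exists z.
Qed.

(** * Residues of integer vectors modulo [m.+1] *)

Section Residues.
Variables (n m : nat).
Local Notation L := 'rV[int]_n.
Local Notation T := 'rV['I_m.+1]_n.
Implicit Types (x y w : L) (a b : T).

(** The remainder is already nonnegative and below [m.+1], so the absolute value and [inord] only
    change its type. *)
Definition residue x : T := \row_j inord `|(x ord0 j %% m.+1)%Z|.

Definition residue_repr a : L := \row_j (nat_of_ord (a ord0 j))%:Z.

Lemma residue_reprK : cancel residue_repr residue.
Proof.
move=> a; apply/rowP => j; rewrite !mxE modz_nat /=.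
by rewrite modn_small // inord_val.
Qed.

Lemma residueK x : exists w, residue_repr (residue x) = x + w *+ m.+1.
Proof.
exists (\row_j - (x ord0 j %/ m.+1)%Z); apply/rowP => j.
have r0 : (0 <= (x ord0 j %% m.+1)%Z)%R by exact: modz_ge0.
have rlt : (`|(x ord0 j %% m.+1)%Z| < m.+1)%N.
  by rewrite -ltz_nat gez0_abs // ltz_mod.
rewrite !mxE inordK // gez0_abs // mulmxnE mxE.
by rewrite {2}(divz_eq (x ord0 j) m.+1) mulNrn -mulr_natr natz addrAC subrr add0r.
Qed.

Lemma residue_repr0 : residue_repr (residue 0) = 0.
Proof. by apply/rowP => j; rewrite !mxE mod0z /= inordK. Qed.

Lemma residueDMn x w : residue (x + w *+ m.+1) = residue x.
Proof.
apply/rowP => j; rewrite !mxE mulmxnE -mulr_natr natz.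
by rewrite addrC modzMDl.
Qed.

Lemma residueD_repr x y : residue (residue_repr (residue x) + y) = residue (x + y).
Proof. by have [w ->] := residueK x; rewrite addrAC residueDMn. Qed.

(* Translating the set [H] by [y] multiplies the sum by [psi y]. *)
Lemma sum_residues_eq0 (F : fieldType) (psi : L -> F) (H : {pred T}) y :
  {morph psi : u v / u + v >-> u * v} -> (forall w, psi (w *+ m.+1) = 1) ->
  (forall a, (residue (residue_repr a + y) \in H) = (a \in H)) -> psi y != 1 ->
  \sum_(a in H) psi (residue_repr a) = 0.
Proof.
move=> psiD psim Hy psiy.
pose t u a := residue (residue_repr a + u).
have tK u : cancel (t u) (t (- u)).
  by move=> a; rewrite /t residueD_repr addrK residue_reprK.
have tbij : bijective (t y).
  by exists (t (- y)) => //; rewrite -{2}[y]opprK; exact: tK.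
have psi_repr x : psi (residue_repr (residue x)) = psi x.
  by have [w ->] := residueK x; rewrite psiD psim mulr1.
set s := \sum_(a in H) _; have : s = s * psi y.
  rewrite {1}/s (reindex (t y)); last exact: onW_bij.
  rewrite mulr_suml; apply: eq_big => [a|a _]; first exact: Hy.
  by rewrite psi_repr psiD.
move=> /eqP; rewrite -subr_eq0 -{1}[s]mulr1 -mulrBr mulf_eq0 subr_eq0 eq_sym.
by rewrite [_ == psi y]eq_sym (negPf psiy) orbF eq_sym => /eqP.
Qed.

End Residues.

(** * Fourier inversion modulo [m.+1] and the characters trivial on S *)

Section Characters.
Variables (F : fieldType) (n m : nat) (z : F).
Hypothesis z_prim : (m.+1).-primitive_root z.
Local Notation L := 'rV[int]_n.
Local Notation T := 'rV['I_m.+1]_n.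
Implicit Types (x y w : L) (a b : T).

(** The standard perfect pairing of (Z/(m+1))^n with itself, lifted to Z^n. *)
Definition pairing x y : F := z ^ (\sum_j x ord0 j * y ord0 j).

Let z0 : z != 0.
Proof. by rewrite (prim_root_eq0 z_prim). Qed.

Lemma pairingC x y : pairing x y = pairing y x.
Proof. by congr (z ^ _); apply: eq_bigr => j _; rewrite mulrC. Qed.

Lemma pairingDr x : {morph pairing x : y w / y + w >-> y * w}.
Proof.
move=> y w; rewrite /pairing -expfzDr // -big_split; congr (z ^ _).
by apply: eq_bigr => j _; rewrite mxE mulrDr.
Qed.

Lemma pairing0r x : pairing x 0 = 1.
Proof. by rewrite /pairing big1 // => j _; rewrite mxE mulr0. Qed.

Lemma pairingMnr x w : pairing x (w *+ m.+1) = 1.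
Proof.
rewrite /pairing (eq_bigr (fun j => m.+1%:Z * (x ord0 j * w ord0 j))) => [|j _].
  by rewrite -mulr_sumr -exprz_exp -exprnP (prim_expr_order z_prim) exp1rz.
by rewrite mulmxnE -mulr_natl natz mulrCA.
Qed.

Lemma pairing_delta x j : pairing x (delta_mx ord0 j) = z ^ (x ord0 j).
Proof.
rewrite /pairing (bigD1 j) //= mxE !eqxx mulr1 big1 ?addr0 // => i /negPf ij.
by rewrite mxE ij andbF mulr0.
Qed.

Lemma pairing_residue x y : pairing (residue_repr (residue m x)) y = pairing x y.
Proof.
have [w ->] := residueK m x.
by rewrite !(pairingC _ y) pairingDr pairingMnr mulr1.
Qed.

Lemma expz_prim_eq1 (i : int) : z ^ i = 1 -> exists q : int, i = q * m.+1%:Z.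
Proof.
move=> zi; exists (i %/ m.+1)%Z; rewrite {1}(divz_eq i m.+1).
have : z ^ (i %% m.+1)%Z = 1.
  move: zi; rewrite {1}(divz_eq i m.+1) expfzDr // mulrC [_ * m.+1%:Z]mulrC.
  by rewrite -exprz_exp -exprnP (prim_expr_order z_prim) exp1rz mulr1.
have : (0 <= (i %% m.+1)%Z)%R by exact: modz_ge0.
have : ((i %% m.+1)%Z < m.+1%:Z)%R by rewrite ltz_mod.
case: (i %% m.+1)%Z => // r rlt _; rewrite -exprnP => /eqP.
rewrite -(prim_order_dvd z_prim) => /eqP; rewrite modn_small // => ->.
by rewrite addr0.
Qed.

(** Orthogonality in contrapositive form: if z^(x_j) differs from 1 for some j, the character
    [pairing x] is nontrivial at the j-th basis vector and its sum vanishes. So every coordinate of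
    [x] is a multiple of [m.+1]. *)
Lemma sum_pairing_neq0 x :
  \sum_(b : T) pairing x (residue_repr b) != 0 -> exists w, x = w *+ m.+1.
Proof.
move=> sx; have zx j : z ^ (x ord0 j) = 1.
  apply/eqP; apply: contraNT sx; rewrite -pairing_delta => xj; apply/eqP.
  by apply: (sum_residues_eq0 (pairingDr x) (pairingMnr x) _ xj) => a.
have [q xq] := choice (fun j => expz_prim_eq1 (zx j)).
by exists (\row_j q j); apply/rowP => j; rewrite mulmxnE mxE xq -mulr_natr natz.
Qed.

Lemma sum_pairing0 : \sum_(b : T) pairing 0 (residue_repr b) = (m.+1 ^ n)%:R.
Proof.
under eq_bigr do rewrite pairingC pairing0r.
by rewrite sumr_const card_mx card_ord mul1n.
Qed.

Variable S : zmodClosed L.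
Hypothesis mS : forall x, x *+ m.+1 \in S.

(** Since [S] contains (m+1)Z^n, it is a union of residue classes; this set represents the quotient
    of [S] by (m+1)Z^n. *)
Definition sublattice_residues : {pred T} := fun a => residue_repr a \in S.

(** The dual group of Z^n/S. Testing finitely many residues keeps it decidable and suffices, because
    the pairing depends only on residues. *)
Definition annihilator : {pred T} := fun a =>
  [forall b, (b \in sublattice_residues) ==>
             (pairing (residue_repr a) (residue_repr b) == 1)].

Lemma annihilatorP a x :
  a \in annihilator -> x \in S -> pairing (residue_repr a) x = 1.
Proof.
move=> /forallP/(_ (residue m x))/implyP ann xS.
rewrite pairingC -pairing_residue pairingC; apply/eqP/ann.
by have [w wE] := residueK m x; rewrite -topredE /= /sublattice_residues wE rpredD.
Qed.

Lemma sum_sublattice_pairing a :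
  \sum_(b in sublattice_residues) pairing (residue_repr a) (residue_repr b) =
  if a \in annihilator then #|sublattice_residues|%:R else 0.
Proof.
case: ifPn => [/annihilatorP ann|].
  by rewrite -sumr_const; apply: eq_bigr => b bS; rewrite ann.
rewrite negb_forall => /existsP[b]; rewrite negb_imply => /andP[bS ab].
apply: (sum_residues_eq0 (pairingDr _) (pairingMnr _) _ ab) => c.
have [w wE] := residueK m (residue_repr c + residue_repr b).
by rewrite -!topredE /= /sublattice_residues wE rpredDr // rpredDr.
Qed.

(* Both sides are the double sum of [pairing a (b + x)] over all residues [a]
   and all residues [b] of the sublattice. *)
Lemma annihilator_poisson x :
  #|sublattice_residues|%:R *
    \sum_(a in annihilator) pairing (residue_repr a) x =
  \sum_(b in sublattice_residues) \sum_(a : T)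
    pairing (residue_repr b + x) (residue_repr a).
Proof.
rewrite exchange_big mulr_sumr big_mkcond; apply: eq_bigr => a _ /=.
transitivity ((\sum_(b in sublattice_residues)
  pairing (residue_repr a) (residue_repr b)) * pairing (residue_repr a) x).
  by rewrite sum_sublattice_pairing; case: ifP => // _; rewrite mul0r.
by rewrite mulr_suml; apply: eq_bigr => b _; rewrite -pairingDr pairingC.
Qed.

Hypothesis m_inv : m.+1%:R != 0 :> F.

(** At x = 0 only the zero residue contributes to the right side of [annihilator_poisson]. The
    cardinality therefore divides (m+1)^n, which is nonzero in F. *)
Lemma card_sublattice_residues_neq0 : #|sublattice_residues|%:R != 0 :> F.
Proof.
have Tinv : (m.+1 ^ n)%:R != 0 :> F by rewrite natrX expf_neq0.
apply: contra_neq Tinv => H0; have := annihilator_poisson 0; rewrite H0 mul0r.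
rewrite (bigD1 (residue m 0)) /=; last first.
  by rewrite -topredE /= /sublattice_residues residue_repr0 rpred0.
rewrite addr0 residue_repr0 sum_pairing0 big1 ?addr0 // => b /andP[_ b0].
apply/eqP; apply: contraNT b0 => /sum_pairing_neq0[w]; rewrite addr0 => bw.
by rewrite -[b]residue_reprK bw -[w *+ _]add0r residueDMn.
Qed.

(** For [x] outside [S] no b + x with [b] in [S] lies in (m+1)Z^n, so the right side of
    [annihilator_poisson] vanishes and the cardinality cancels. *)
Lemma sum_annihilator_notin x : x \notin S ->
  \sum_(a in annihilator) pairing (residue_repr a) x = 0.
Proof.
move=> xS; apply: (mulfI card_sublattice_residues_neq0).
rewrite annihilator_poisson mulr0 big1 // => b bS; apply/eqP.
apply: contraNT xS => /sum_pairing_neq0[w wE].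
by rewrite -(rpredDr _ bS) addrC wE.
Qed.

(** After exchanging the sums, summing over all residues [b] kills every character except the
    trivial one, which contributes 1 for each [b]. *)
Lemma sum_annihilator_translates x :
  \sum_(b : T) \sum_(a in annihilator)
    pairing (residue_repr a) (x - residue_repr b) =
  (m.+1 ^ n)%:R.
Proof.
rewrite exchange_big /=.
have pairingNN u v : pairing u (- v) = pairing (- u) v.
  by congr (z ^ _); apply: eq_bigr => j _; rewrite !mxE mulrN mulNr.
rewrite (bigD1 (residue m 0)) /=; last first.
  by apply/forallP => b; rewrite residue_repr0 pairingC pairing0r eqxx implybT.
rewrite residue_repr0 -sum_pairing0 [X in _ + X]big1 ?addr0.
  by apply: eq_bigr => b _; rewrite !(pairingC 0) !pairing0r.
move=> a /andP[_ a0].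
under eq_bigr do rewrite pairingDr pairingNN.
rewrite -mulr_sumr; apply/eqP; rewrite mulf_eq0; apply/orP; right.
apply: contraNT a0 => /sum_pairing_neq0[w wE].
rewrite -[a]residue_reprK -[residue_repr a]opprK wE -mulNrn.
by rewrite -[_ *+ _]add0r residueDMn.
Qed.

End Characters.

(** * Descent of an invariant module to A_S *)

Lemma mcoeff_sum (F : fieldType) n (I : Type) (r : seq I) (P : pred I)
    (f : I -> laurent F n) x :
  (\sum_(i <- r | P i) f i)@_x = \sum_(i <- r | P i) (f i)@_x.
Proof. exact: raddf_sum. Qed.

Lemma mcoeff_sigmaM (F : fieldType) n x y (a : laurent F n) :
  (sigma F x * a)@_y = a@_(y - x).
Proof.
transitivity (\sum_(w <- msupp a) a@_w * (x + w == y)%:R).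
  rewrite [in LHS](laurentE a) mulr_sumr [LHS]mcoeff_sum.
  apply: eq_bigr => w _; rewrite -scalerAr -sigmaD [LHS]mcoeffZ.
  by rewrite mcoeffU.
rewrite [in RHS](laurentE a) [RHS]mcoeff_sum; apply: eq_bigr => w _.
by rewrite [RHS]mcoeffZ mcoeffU eq_sym -subr_eq0 opprD addrA subr_eq0 eq_sym.
Qed.

Section Descent.
Variables (F : fieldType) (n k : nat) (S : zmodClosed 'rV[int]_n).
Local Notation A := (laurent F n).
Local Notation AS := (sublaurent F S).
Variables (I J : finType) (D : {pred J}).
Variables (chi : J -> 'rV[int]_n -> F) (y : I -> 'rV[int]_n) (c : F).
Hypotheses (chi0 : forall j, chi j 0 = 1)
  (chiD : forall j, {morph chi j : u v / u + v >-> u * v})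
  (chiS : forall j x, j \in D -> x \in S -> chi j x = 1)
  (chi_notin : forall x, x \notin S -> \sum_(j in D) chi j x = 0)
  (chi_total : forall x, \sum_i \sum_(j in D) chi j (x - y i) = c)
  (c_neq0 : c != 0).

Definition average (a : A) : A := \sum_(j in D) twist (chi j) a.

Lemma mcoeff_average a x : (average a)@_x = (\sum_(j in D) chi j x) * a@_x.
Proof.
rewrite [LHS]mcoeff_sum mulr_suml; apply: eq_bigr => j _.
exact: mcoeff_twist.
Qed.

Lemma average_span a : average a \in @monomial_span F n S.
Proof.
apply: supp_monomial_span => x; rewrite mcoeff_average.
by apply: contraNT => /chi_notin ->; rewrite mul0r.
Qed.

(** Conjugating [average] by sigma^(y i) changes its multiplier on the coefficient at [x] into the
    one at x - y i; by [chi_total] these add up to [c]. *)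
Lemma average_total a :
  \sum_i sigma F (y i) * average (sigma F (- y i) * a) = c *: a.
Proof.
apply/malgP => x; rewrite [LHS]mcoeff_sum [RHS]mcoeffZ -(chi_total x) mulr_suml.
apply: eq_bigr => i _; rewrite mcoeff_sigmaM mcoeff_average mcoeff_sigmaM.
by rewrite opprK subrK.
Qed.

Variable P : set 'rV[A]_k.
Hypotheses (hP : is_submodule P) (Pinv : aut_invariant S P).

(** The contraction of [P]: it contains every module over A_S whose extension is [P]. *)
Definition trace_module : set 'rV[AS]_k := [set q | P (map_mx val q)]%classic.

Lemma trace_module_submodule : is_submodule trace_module.
Proof.
apply: is_submoduleP => [|a u v Pu Pv]; rewrite /trace_module /=.
  suff -> : map_mx val (0 : 'rV[AS]_k) = 0 by exact: submodule0 hP.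
  by apply/matrixP => r s; rewrite !mxE raddf0.
suff -> : map_mx val (a *: u + v) = val a *: map_mx val u + map_mx val v.
  exact: (submoduleZD hP).
by apply/matrixP => r s; rewrite !mxE raddfD; congr (_ + _); exact: rmorphM.
Qed.

Lemma average_mem p : P p -> P (map_mx average p).
Proof.
move=> Pp; have -> : map_mx average p = \sum_(j in D) map_mx (twist (chi j)) p.
  by apply/matrixP => r s; rewrite summxE mxE; apply: eq_bigr => j _; rewrite mxE.
apply: (submodule_sum hP) => j jD.
(* Invariance enters here: each summand is the image of [p] under an automorphism over A_S. *)
rewrite -(Pinv (twist_is_aut_over (chi0 j) (chiD j) (fun x => chiS jD))).
by exists p.
Qed.

Lemma extended_trace_module : extended_module trace_module = P.
Proof.
have hE := extended_module_submodule trace_module.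
apply/seteqP; split; first by apply: smallest_sub => // _ [q Pq <-].
move=> p Pp.
have avgE q : P q -> extended_module trace_module (map_mx average q).
  move=> Pq; apply: sub_gen_smallest.
  have valE : map_mx val (map_mx (insubd (0 : AS)) (map_mx average q)) =
      map_mx average q.
    by apply/matrixP => r s; rewrite !mxE insubdK //; exact: average_span.
  exists (map_mx (insubd (0 : AS)) (map_mx average q)) => //.
  by rewrite /trace_module /= valE; exact: average_mem.
(* This is [average_total] in each coordinate, divided by [c]; the averaged vectors are generators
   coming from A_S. *)
have -> : p = (c^-1)%:A *:
    \sum_i sigma F (y i) *: map_mx average (sigma F (- y i) *: p).
  apply/matrixP => r s; rewrite mxE summxE.
  rewrite (eq_bigr (fun i =>
    sigma F (y i) * average (sigma F (- y i) * p r s))); last first.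
    by move=> i _; rewrite !mxE.
  by rewrite average_total -scalerAl mul1r scalerA mulVf // scale1r.
apply: (submoduleZ hE); apply: (submodule_sum hE) => i _.
by apply: (submoduleZ hE); apply: avgE; apply: (submoduleZ hP).
Qed.

End Descent.

Theorem theorem5p1 (n k : nat) (hn : (1 <= n)%N) (hk : (1 <= k)%N)
    (S : zmodClosed 'rV[int]_n) (hS : full_rank S)
    (F : closedFieldType)
    (hF : is_complex_field F \/
          exists2 p : nat, p \in [pchar F] & coprime p (lattice_index S))
    (P : set 'rV[laurent F n]_k) (hP : is_submodule P) :
  (exists2 B : set ('I_k -> lattice S -> F),
      is_system_S B & is_extension (ker_L P) B)
  <-> aut_invariant S P.
Proof.
split=> [[B _ [Q [_ _ kerPQ]]]|Pinv].
  (* Both are submodules with the same [ker_L], so [ker_L_subset] applied in each direction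
     identifies them. *)
  suff -> : P = extended_module Q by exact: extended_module_aut_invariant.
  apply/seteqP; split; apply: ker_L_subset; rewrite ?kerPQ //.
  exact: extended_module_submodule.
have [m m_neq0 mS] := invertible_exponent hS hF.
have [z z_prim] := closed_field_prim_root m_neq0.
case: m => [|m] in m_neq0 mS z_prim; first by rewrite eqxx in m_neq0.
pose Q : set 'rV[sublaurent F S]_k := trace_module P.
have PE : extended_module Q = P.
  (* The averaging characters are those trivial on [S], the shifts run over all residues, and the
     constant (m+1)^n counts these residues. *)
  refine (@extended_trace_module F n k S _ _ (annihilator z S)
    (fun a => pairing z (residue_repr a)) (@residue_repr n m) (m.+1 ^ n)%:R
    _ _ _ _ _ _ P hP Pinv).
  - by move=> a; exact: pairing0r.
  - by move=> a; exact: (pairingDr z_prim).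
  - by move=> a x; exact: (annihilatorP z_prim mS).
  - by move=> x; exact: (sum_annihilator_notin z_prim mS m_neq0).
  - by move=> x; exact: (sum_annihilator_translates z_prim).
  - by rewrite natrX expf_neq0.
have hQ : is_submodule Q by exact: trace_module_submodule.
by exists (ker_S Q); exists Q; rewrite ?PE.
Qed.
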